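(* Let $G$ be a group and let $H$ be a normal subgroup of $G$ of finite index. Let $X \subset G$ be a set of coset representatives for $H$ in $G$ (so $X$ contains exactly one element of each coset of $H$). Define \[ C(X)=\frac{|\{(x,y)\in X\times X : xy\in X\}|}{|X|^2}. \] If $C(X)>7/9$, then there is a subgroup $K$ of $G$ with $HK=G$ and $H\cap K=\{1\}$.
   Context: $C(X)$ is the proportion of ordered pairs $(x,y)\in X\times X$ for which no (non-trivial) carry occurs, i.e. for which the product $xy$ is again one of the chosen coset representatives. *)

(* Defs.v *)
From HB Require Import structures.
From mathcomp Require Import all_boot all_order all_algebra finmap.
From mathcomp Require Import boolp classical_sets functions cardinality.

Set Implicit Arguments.
Unset Strict Implicit.
Unset Printing Implicit Defensive.

Local Open Scope group_scope.
Local Open Scope classical_set_scope.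

Section Definitions.
Variable G : groupType.
Implicit Types H K X : set G.

Definition subgroup H : Prop := group_closed (mem H).

Definition normal_subgroup H : Prop :=
  subgroup H /\ forall h g : G, H h -> H (h ^ g).

Definition left_coset H (g : G) : set G := [set g * h | h in H].

Definition finite_index H : Prop := finite_set (range (left_coset H)).

Definition coset_representatives H X : Prop :=
  forall g : G, exists! x : G, X x /\ left_coset H g x.

Definition no_carry_pairs X : set (G * G) :=
  [set p | [/\ X p.1, X p.2 & X (p.1 * p.2)]].

(* [fset_set A] is the empty finite set when [A] is infinite, so this is the
   intended proportion only for finite [X]; representatives of a subgroup of
   finite index always form a finite set. *)
Definition C X : rat :=
  (#|` fset_set (no_carry_pairs X)|%:R / #|` fset_set X|%:R ^+ 2)%R.

Definition set_mul H K : set G := [set h * k | h in H & k in K].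

End Definitions.

(* Main.v *)
Require Import Defs.
From HB Require Import structures.
From mathcomp Require Import all_boot all_order all_algebra finmap.
From mathcomp Require Import boolp classical_sets functions cardinality.
From mathcomp Require Import zify.

Local Open Scope classical_set_scope.

(** The argument is the self-correction of approximate homomorphisms. For [g]
    in [G] let [g y] reduce to the representative [y'], and call [y' y^-1] the
    vote of [y] on [g]. If at most a proportion [d < 2/9] of the pairs carry,
    then the votes of two random representatives on [g] agree with probability
    at least [1 - 2 d > 5/9 = (2/3)^2 + (1/3)^2], so one value [phi g] gets more
    than two thirds of the votes. Three events of probability more than [2/3]
    intersect, which gives [phi (g h) = phi g * phi h]. As [phi g] lies in [g H]
    and [phi] is trivial on [H], the image of [phi] is a complement of [H]. *)

(** Let the most popular value have [p] of the n votes. Every voter disagrees with at least n - p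
    others, so S >= n(n - p); counting disagreements across the split between winners and losers
    from both sides gives S >= 2p(n - p). The first bound forces p > 5n/9, and the second then
    excludes p <= 2n/3. *)
Lemma two_thirds_majority (T : finType) (V : eqType) (f : T -> V) :
  9 * (\sum_(y : T) #|[pred z | f z != f y]|) < 4 * #|T| ^ 2 ->
  exists v, 2 * #|T| < 3 * #|[pred y | f y == v]|.
Proof.
move=> Hf.
have T_gt0 : 0 < #|T| by case: #|T| Hf => //; rewrite !muln0.
have /card_gt0P [t0 _] := T_gt0.
pose m v := #|[pred z | f z == v]|.
have cardN v : #|[pred z | f z != v]| = #|T| - m v.
  by rewrite -(cardC [pred z | f z == v]) addKn; apply: eq_card.
have [y0 _ y0max] := arg_maxnP (fun y => m (f y)) (erefl (xpredT t0)).
set p := m (f y0) in y0max.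
have ple : p <= #|T| := max_card _.
exists (f y0); rewrite -/(m (f y0)) -/p.
move: Hf; under eq_bigr => y _ do rewrite cardN.
set S := \sum_(y : T) _ => HS.
have S_ge1 : #|T| * (#|T| - p) <= S.
  rewrite -sum_nat_const; apply: leq_sum => y _.
  by apply: leq_sub2l; apply: y0max.
have S_ge2 : 2 * (p * (#|T| - p)) <= S.
  rewrite /S (bigID (fun y => f y == f y0)) /= mul2n -addnn.
  apply: leq_add.
    rewrite -sum_nat_const; apply: leq_sum => y /eqP ->.
    exact: leqnn.
  rewrite mulnC -cardN -sum_nat_const; apply: leq_sum => y fy.
  (* Restated: the points agreeing with the loser [y] all lie outside the winning class. *)
  rewrite leq_subRL ?max_card // addnC -leq_subRL // -cardN.
  apply: subset_leq_card; apply/fintype.subsetP => z; rewrite !inE => /eqP ->.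
  exact: fy.
nia.
Qed.

Lemma card_pred_inj (T : finType) (f : T -> T) (P : pred T) :
  injective f -> #|[pred z | P (f z)]| = #|[pred z | P z]|.
Proof. by move=> f_inj; rewrite -!sum1_card [RHS](reindex_inj f_inj). Qed.

Lemma three_majorities_meet (T : finType) (P Q R : pred T) :
  2 * #|T| < 3 * #|P| -> 2 * #|T| < 3 * #|Q| -> 2 * #|T| < 3 * #|R| ->
  exists t, [/\ P t, Q t & R t].
Proof.
move=> hP hQ hR.
have PQ := cardUI P Q.
have PQR : #|[predU [predI P & Q] & R]| + #|[predI [predI P & Q] & R]|
    = #|[predI P & Q]| + #|R| := cardUI _ _.
have U1 : #|[predU P & Q]| <= #|T| := max_card _.
have U2 : #|[predU [predI P & Q] & R]| <= #|T| := max_card _.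
have [t|I0] := pickP [predI [predI P & Q] & R].
  by rewrite !inE => /andP[/andP[Pt Qt] Rt]; exists t.
by rewrite (eq_card0 I0) in PQR; lia.
Qed.

Section SelfCorrection.
Local Open Scope group_scope.
(** Model: [T] indexes the representatives, [v] is their inclusion in [G], and [act g] multiplies by
    [g] on the left and reduces modulo [H]. Under this reading [act_val] reflects the normality of
    [H]. *)
Context {G : groupType} {T : finType} (v : T -> G) (act : G -> T -> T).
Hypothesis act_inj : forall g, injective (act g).
Hypothesis actM : forall g h t, act (g * h) t = act g (act h t).
Hypothesis act_val : forall g y t, act (v (act g y)) t = act (g * v y) t.

Definition vote (g : G) (y : T) : G := v (act g y) * (v y)^-1.

Definition carry (x y : T) : bool := v (act (v x) y) != v x * v y.

(** Substitute z = [act (v y) u]. If neither ([y], [u]) nor ([act g y], [u]) carries, then [v u]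
    cancels in the vote of z, which leaves the vote of [y]. Summed over [y], each kind of exception
    counts every carrying pair once, as [act g] permutes [T]. *)
Lemma vote_disagreement (g : G) :
  (\sum_(y : T) #|[pred z | vote g z != vote g y]|
    <= 2 * \sum_(x : T) #|[pred y | carry x y]|)%N.
Proof.
have step y : (#|[pred z | vote g z != vote g y]|
    <= #|[pred u | carry y u]| + #|[pred u | carry (act g y) u]|)%N.
  rewrite -(card_pred_inj _ _ _ (act_inj (v y))) -cardUI.
  apply: leq_trans (leq_addr _ _).
  apply: subset_leq_card; apply/fintype.subsetP => u; rewrite !inE.
  apply: contraR; rewrite negb_or !negbK => /andP[/eqP e1 /eqP e2].
  by rewrite /vote -actM -act_val e1 e2 invgM !mulgA mulgK.
rewrite mul2n -addnn [X in (_ <= _ + X)%N](reindex_inj (act_inj g)) /=.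
by rewrite -big_split /=; apply: leq_sum => y _; apply: step.
Qed.

Lemma vote_morphism :
  (9 * (\sum_(x : T) #|[pred y | carry x y]|) < 2 * #|T| ^ 2)%N ->
  exists phi : G -> G, (forall g h, phi (g * h) = phi g * phi h) /\
    forall g, (2 * #|T| < 3 * #|[pred y | vote g y == phi g]|)%N.
Proof.
move=> Hc.
have [phi phiP] : {phi : G -> G &
    forall g, (2 * #|T| < 3 * #|[pred y | vote g y == phi g]|)%N}.
  apply: (choice (P := fun g w =>
    (2 * #|T| < 3 * #|[pred y | vote g y == w]|)%N)) => g; apply: two_thirds_majority.
  by have := vote_disagreement g; lia.
exists phi; split=> // g h.
(* Translating voters by [act h] preserves the majority on [g], and the vote of z on [g * h] is the
   vote of [act h z] on [g] times the vote of z on [h]. *)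
have gP : (2 * #|T| < 3 * #|[pred z | vote g (act h z) == phi g]|)%N.
  by rewrite (card_pred_inj _ (act h) (fun z => vote g z == phi g)).
have [z [/= /eqP <- /eqP <- /eqP <-]] :=
  three_majorities_meet _ _ _ _ (phiP (g * h)) gP (phiP h).
by rewrite /vote actM mulgA mulgVK.
Qed.

End SelfCorrection.

Section Representatives.
Local Open Scope group_scope.
Context {G : groupType} {H X : set G}.
Hypotheses (normH : normal_subgroup H) (repX : coset_representatives H X).

Lemma normal1 : H 1.
Proof. by case: normH => -[/set_mem]. Qed.

Lemma normalM {x y} : H x -> H y -> H (x * y).
Proof.
by case: normH => sH _ /mem_set Hx /mem_set Hy; apply/set_mem/(group_closedM sH).
Qed.

Lemma normalV {x} : H x -> H x^-1.
Proof.
by case: normH => sH _ /mem_set Hx; apply/set_mem/(group_closedV sH).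
Qed.

Lemma normalJ {x} y : H x -> H (x ^ y).
Proof. by case: normH => _; apply. Qed.

(** The default 1 is never taken, since each coset meets [X]. *)
Definition rep (g : G) : G := xget 1 [set x | X x /\ H (g^-1 * x)].

Lemma repP g : X (rep g) /\ H (g^-1 * rep g).
Proof.
apply: (@xgetPex _ 1 [set x | X x /\ H (g^-1 * x)]).
have [x [[Xx [h Hh ghx]] _]] := repX g.
by exists x; split=> //=; rewrite -ghx mulKg.
Qed.

Lemma rep_uniq g x : X x -> H (g^-1 * x) -> rep g = x.
Proof.
move=> Xx Hx; have [y [_ uy]] := repX g.
have [Xr Hr] := repP g.
rewrite -(uy (rep g)) ?(uy x) //; split=> //.
  by exists (g^-1 * x); rewrite // mulVKg.
by exists (g^-1 * rep g); rewrite // mulVKg.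
Qed.

Lemma rep_id x : X x -> rep x = x.
Proof. by move=> Xx; apply: rep_uniq => //; rewrite mulVg; apply: normal1. Qed.

Lemma eq_rep g h : H (g^-1 * h) -> rep g = rep h.
Proof.
move=> gh; have [Xr Hr] := repP h; apply: rep_uniq => //.
by have := normalM gh Hr; rewrite mulgA mulgK.
Qed.

Lemma rep_mulr g h : rep (g * rep h) = rep (g * h).
Proof.
apply/esym/eq_rep; rewrite invgM -mulgA mulKg.
exact: (repP h).2.
Qed.

(** The two arguments differ by the conjugate by [h] of an element of [H], so normality enters
    here. *)
Lemma rep_mull g h : rep (rep g * h) = rep (g * h).
Proof.
apply/esym/eq_rep; rewrite invgM -mulgA [X in H (_ * X)]mulgA.
exact/normalJ/(repP g).2.
Qed.

End Representatives.

Section Complement.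
Local Open Scope group_scope.
Context {G : groupType} {H X : set G}.
Hypotheses (normH : normal_subgroup H) (repX : coset_representatives H X).
Hypothesis finX : finite_set X.

Let T : finType := fset_sub_type (fset_set X).

Lemma fset_rep_in g : @rep G H X g \in fset_set X.
Proof. by rewrite in_fset_set //; apply/mem_set; exact: (repP repX g).1. Qed.

Let act (g : G) (t : T) : T := [` fset_rep_in (g * val t)]%fset.

Lemma valX (t : T) : X (val t).
Proof. by apply/set_mem; rewrite -in_fset_set //; apply: valP. Qed.

Lemma rep_action_inj g : injective (act g).
Proof.
move=> s t /(congr1 val) /= e; apply/val_inj.
have := congr1 (fun x => @rep G H X (g^-1 * x)) e.
by rewrite /= !(rep_mulr normH repX) // !mulKg !(rep_id normH repX) //; apply: valX.
Qed.

Lemma rep_actionM g h t : act (g * h) t = act g (act h t).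
Proof. by apply/val_inj; rewrite /= (rep_mulr normH repX) mulgA. Qed.

Lemma rep_action_val g y t : act (val (act g y)) t = act (g * val y) t.
Proof. by apply/val_inj; rewrite /= (rep_mull normH repX). Qed.

(** A product already in [X] is its own representative, so such a pair does not carry. This
    inequality turns many products in [X] into few carries. *)
Lemma card_no_carry_pairs :
  (#|` fset_set (no_carry_pairs X)| +
   \sum_(x : T) #|[pred y | carry (val : T -> G) act x y]| <= #|T| ^ 2)%N.
Proof.
have fin2 : finite_set (no_carry_pairs X).
  apply: (sub_finite_set _ (finite_setX finX finX)).
  by move=> p [Xp1 Xp2 _].
have -> : (\sum_(x : T) #|[pred y | carry (val : T -> G) act x y]| =
    #|[pred p : T * T | carry (val : T -> G) act p.1 p.2]|)%N.
  rewrite -sum1_card (eq_bigr (fun x => \sum_(y | carry (val : T -> G) act x y) 1)%N).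
    by rewrite pair_big_dep.
  by move=> x _; rewrite sum1_card.
rewrite -mulnn -card_prod -(cardC [pred p : T * T | carry (val : T -> G) act p.1 p.2]).
rewrite addnC leq_add2l.
pose P := [pred p : T * T | ~~ carry (val : T -> G) act p.1 p.2].
have sub : (fset_set (no_carry_pairs X) `<=`
    [fset (val p.1, val p.2) | p in P])%fset.
  apply/fsubsetP => -[x y]; rewrite in_fset_set // => /set_mem [/= Xx Xy Xxy].
  have Tx : x \in fset_set X by rewrite in_fset_set //; apply/mem_set.
  have Ty : y \in fset_set X by rewrite in_fset_set //; apply/mem_set.
  apply/imfsetP; exists ([` Tx]%fset, [` Ty]%fset) => //=.
  by rewrite inE /carry /= negbK (rep_id normH repX).
apply: leq_trans (fsubset_leq_card sub) _.
apply: leq_trans (leq_imfset_card _ _ _) _.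
by rewrite cardE.
Qed.

Lemma complement_of_few_carries :
  (7 * #|` fset_set X| ^ 2 < 9 * #|` fset_set (no_carry_pairs X)|)%N ->
  exists K : set G, [/\ subgroup K, set_mul H K = setT & H `&` K = [set 1]].
Proof.
rewrite cardfE -[#|_|]/#|T| => Hc.
have [|phi [phiM phiP]] := @vote_morphism G T val act
  rep_action_inj rep_actionM rep_action_val.
  by have := card_no_carry_pairs; lia.
have voteE g : exists y : T, phi g = vote val act g y.
  have /card_gt0P[y] : (0 < #|[pred y : T | vote val act g y == phi g]|)%N.
    by rewrite -(@ltn_pmul2l 3) //; apply: leq_ltn_trans (phiP g).
  by rewrite inE => /eqP <-; exists y.
(* For a voter y this is a conjugate of (gy)^-1 [rep](gy). *)
have phiH g : H (phi g * g^-1).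
  have [y ->] := voteE g; rewrite /vote /= -mulgA -invgM.
  have := normalJ normH (g * val y)^-1 (repP repX (g * val y)).2.
  by rewrite conjgE invgK mulgA mulVKg.
(* Multiplying by an element of [H] does not change the coset, so every vote on it is 1. *)
have phi1 h : H h -> phi h = 1.
  move=> Hh; have [y ->] := voteE h; rewrite /vote /=.
  rewrite (rep_uniq repX _ (val y)) ?mulgV //; first exact: valX.
  rewrite invgM -mulgA.
  exact/normalJ/normalV.
have phi_1 : phi 1 = 1 by apply: phi1; apply: normal1.
have phiV g : phi g^-1 = (phi g)^-1.
  by apply: (@mulgI _ (phi g)); rewrite -phiM !mulgV.
exists (range phi); split.
- split; first by apply/mem_set; exists 1.
  move=> _ _ /set_mem[g _ <-] /set_mem[h _ <-]; apply/mem_set.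
  by exists (g / h) => //; rewrite phiM phiV.
- apply/seteqP; split=> // g _.
  exists (g * (phi g)^-1).
    by rewrite -[g]invgK -invgM invgK; apply: normalV; rewrite // phiH.
  by exists (phi g); [exists g | rewrite mulgVK].
- apply/seteqP; split=> [x [Hx [g _ gx]]|_ ->] /=.
    (* If [phi g] lies in [H], then so does [g] by [phiH]. *)
    rewrite -gx in Hx *; apply: phi1; have := normalM normH (normalV normH (phiH g)) Hx.
    by rewrite invgM invgK mulgVK.
  by split; [apply: normal1 | exists 1].
Qed.

End Complement.

Theorem theorem1p1 (G : groupType) (H X : set G)
    (normH : normal_subgroup H) (finH : finite_index H)
    (repX : coset_representatives H X) (CX : (7%:R / 9%:R < C X)%R) :
  exists K : set G,
    [/\ subgroup K, set_mul H K = setT & H `&` K = [set 1%g]].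
Proof.
(* Otherwise [C X] would be 0, the inverse of 0 being 0. *)
have X_gt0 : 0 < #|` fset_set X|.
  rewrite lt0n; apply: contraTneq CX => X0.
  by rewrite /C X0 GRing.expr0n GRing.invr0 GRing.mulr0 -Order.TotalTheory.leNgt.
(* [fset_set X] is empty, and [C X] is then [0], if [X] is infinite. *)
have finX : finite_set X.
  apply: contrapT => infX; move: X_gt0.
  by rewrite /fset_set; case: pselect => //; rewrite cardfs0.
apply: (complement_of_few_carries normH repX finX).
move: CX; rewrite /C Num.Theory.ltr_pdivlMr ?Num.Theory.exprn_gt0 ?Num.Theory.ltr0n //.
rewrite GRing.mulrAC Num.Theory.ltr_pdivrMr ?Num.Theory.ltr0n //.
by rewrite -GRing.natrX -!GRing.natrM Num.Theory.ltr_nat [X in _ < X]mulnC.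
Qed.
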